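(* Assume that a saddle point exists ($\mathcal{M}^*\neq\emptyset$), that each $f_i:\mathbb{R}^n\to\mathbb{R}$ is convex and differentiable with $L_i$-Lipschitz continuous gradient, and that each $g_i:\mathbb{R}^p\to(-\infty,+\infty]$ is convex, proper and closed ($i=1,\dots,m$). Assume $0<\tau_i<2/L_i$ and $0<\tau_i\beta<1$ for $i=1,\dots,m$. Let $\mathbf{w}^k=(\mathbf{x}^k,\mathbf{y}^k)$ and $\mathbf{v}^{k}=(\bar{\mathbf{x}}^{k},\mathbf{y}^{k})$ be generated by DISA. Then, as $K\to\infty$: 1. $\displaystyle \frac1K\sum_{k=0}^{K-1}\|\mathbf{w}^k-\mathbf{v}^{k+1}\|^2_{\mathbf{M}}=O(1/K)$; 2. $\displaystyle \min_{0\le k\le K-1}\|\mathbf{w}^k-\mathbf{v}^{k+1}\|^2_{\mathbf{M}}=o(1/K)$; 3. $\displaystyle \frac1K\sum_{k=0}^{K-1}\mathrm{dist}^2\big(0,\mathcal{T}(\mathbf{v}^{k+1})\big)=O(1/K)$; 4. $\displaystyle \min_{0\le k\le K-1}\mathrm{dist}^2\big(0,\mathcal{T}(\mathbf{v}^{k+1})\big)=o(1/K)$.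
   Context: Network and problem. $\mathcal{G}=(\mathcal{V},\mathcal{E})$ is an undirected connected graph with $m$ nodes. $W=[W_{ij}]\in\mathbb{R}^{m\times m}$ is symmetric and doubly stochastic with $\mathrm{null}(I-W)=\mathrm{Span}(1_m)$ ($1_m$ the all-ones vector), $W_{ij}=0$ if $i\neq j$ and $(i,j)\notin\mathcal{E}$, and $W_{ij}>0$ otherwise; consequently $1$ is a simple eigenvalue of $W$ and all other eigenvalues lie in $(-1,1)$. $U_i\in\mathbb{R}^{p\times n}$ are given matrices, $L_i>0$. Lifted form. For $\mathbf{x}=(\mathrm{x}_1,\mathrm{x}_2)\in\mathbb{R}^{mn}\times\mathbb{R}^{mp}=\mathbb{R}^{m(n+p)}$ with blocks $\mathrm{x}_{1,i}\in\mathbb{R}^n$, $\mathrm{x}_{2,i}\in\mathbb{R}^p$, let $F(\mathbf{x})=\sum_{i=1}^m f_i(\mathrm{x}_{1,i})$, $G(\mathbf{x})=\sum_{i=1}^m g_i(\mathrm{x}_{2,i})$, $\mathbf{V}=\frac12(I-W)\otimes I_n$, $\mathbf{U}=\mathrm{diag}\{U_1,\dots,U_m\}$ and $$\mathbf{B}=\begin{pmatrix}\sqrt{\mathbf{V}}&0\\ \mathbf{U}&-I\end{pmatrix},$$ where $\sqrt{\mathbf V}$ is the positive semidefinite square root. The Lagrangian is $\mathcal{L}(\mathbf{x},\mathbf{y})=F(\mathbf{x})+G(\mathbf{x})+\langle\mathbf{y},\mathbf{B}\mathbf{x}\rangle$, $\mathbf{y}\in\mathbb{R}^{m(n+p)}$.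 $\mathcal{M}^*$ is the set of saddle points of $\mathcal{L}$. The KKT (set-valued) mapping is $$\mathcal{T}(\mathbf{x},\mathbf{y})=\begin{pmatrix}\partial G(\mathbf{x})+\nabla F(\mathbf{x})+\mathbf{B}^{\top}\mathbf{y}\\-\mathbf{B}\mathbf{x}\end{pmatrix},$$ and $\mathrm{dist}(0,C)=\inf_{c\in C}\|c\|$. DISA. Given $\tau_i>0$, $\beta>0$, put $\tau=\max_i\tau_i$, $\Gamma_1=\mathrm{diag}\{\tau_1I_n,\dots,\tau_mI_n\}$, $\Gamma_2=\mathrm{diag}\{\tau_1I_p,\dots,\tau_mI_p\}$, $\Gamma=\mathrm{diag}\{\Gamma_1,\Gamma_2\}$, and $$\mathbf{Q}=\begin{pmatrix}\frac1\beta I&0\\0&\mathbf{S}\end{pmatrix},\qquad \mathbf{S}=2\Gamma_2+\mathbf{U}\Gamma_1\mathbf{U}^{\top}+\frac{\beta}{1-\tau\beta}\mathbf{U}\Gamma_1^2\mathbf{U}^{\top}.$$ For symmetric positive (semi)definite $H$, $\|z\|_H^2=\langle z,Hz\rangle$, and $\mathrm{prox}^{\Gamma^{-1}}_{G}(\mathbf{v})=\arg\min_{\mathbf{x}}\{G(\mathbf{x})+\frac12\|\mathbf{x}-\mathbf{v}\|^2_{\Gamma^{-1}}\}$. Starting from arbitrary $\mathbf{x}^0$ and $\mathbf{y}^0=0$, DISA iterates for $k\ge0$: $$\bar{\mathbf{x}}^{k+1}=\mathrm{prox}^{\Gamma^{-1}}_{G}\big(\mathbf{x}^k-\Gamma\nabla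 F(\mathbf{x}^k)-\Gamma\mathbf{B}^{\top}\mathbf{y}^k\big),$$ $$\mathbf{y}^{k+1}=\arg\min_{\mathbf{y}}\Big\{\tfrac12\|\mathbf{y}-\mathbf{y}^k\|^2_{\mathbf{Q}}-\langle\mathbf{B}^{\top}\mathbf{y},\bar{\mathbf{x}}^{k+1}\rangle\Big\},$$ $$\mathbf{x}^{k+1}=\mathrm{prox}^{\Gamma^{-1}}_{G}\big(\mathbf{x}^k-\Gamma\nabla F(\mathbf{x}^k)-\Gamma\mathbf{B}^{\top}\mathbf{y}^{k+1}\big).$$ Metric. $\mathbf{L}_F=\mathrm{diag}\{L_1I_n,\dots,L_mI_n,L_1I_p,\dots,L_mI_p\}$ and $\mathbf{M}=\mathrm{diag}\{\Gamma^{-1}-\frac12\mathbf{L}_F,\ \mathbf{Q}-\mathbf{B}\Gamma\mathbf{B}^{\top}\}$ acting on $(\mathbf{x},\mathbf{y})$; it is positive definite under the step-size condition. *)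

(* Defs.v *)
From HB Require Import structures.
From mathcomp Require Import all_boot all_order all_algebra.
From mathcomp Require Import all_classical all_reals all_analysis.

Set Implicit Arguments.
Unset Strict Implicit.
Unset Printing Implicit Defensive.

Import Order.TTheory GRing.Theory Num.Theory.
Import numFieldNormedType.Exports.
Local Open Scope classical_set_scope.
Local Open Scope ring_scope.

Section Euclidean.
Context {R : realType}.

Definition dot {d} (u v : 'cV[R]_d) : R := \sum_i u i 0 * v i 0.

(* The norm that MathComp-Analysis puts on matrices is the sup norm; it is used
   only through the topology it induces. *)
Definition enorm {d} (u : 'cV[R]_d) : R := Num.sqrt (dot u u).

Definition wnorm2 {d} (H : 'M[R]_d) (u : 'cV[R]_d) : R := dot u (H *m u).

Definition psd {d} (A : 'M[R]_d) : Prop :=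
  A^T = A /\ forall u : 'cV[R]_d, 0 <= dot u (A *m u).

(* Meant for a psd A, where the set below is a singleton. *)
Definition psd_sqrt {d} (A : 'M[R]_d) : 'M[R]_d :=
  xget 0 [set S | psd S /\ S *m S = A].

(* Meant at points u where f is differentiable. *)
Definition grad {d} (f : 'cV[R]_d -> R) (u : 'cV[R]_d) : 'cV[R]_d :=
  \col_i 'd (f : _ -> R^o) u (delta_mx i 0).

End Euclidean.

Section ConvexAnalysis.
Context {R : realType}.
Local Open Scope ereal_scope.

Definition proper_fun {d} (g : 'cV[R]_d -> \bar R) : Prop :=
  (forall u, g u != -oo) /\ exists u, g u != +oo.

Definition econvex {d} (g : 'cV[R]_d -> \bar R) : Prop :=
  forall (u v : 'cV[R]_d) (t : R), (0 < t < 1)%R ->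
    g (t *: u + (1 - t) *: v)%R <= t%:E * g u + (1 - t)%:E * g v.

(* Closedness of a function is closedness of its epigraph. *)
Definition closed_fun {d} (g : 'cV[R]_d -> \bar R) : Prop :=
  closed [set q : 'cV[R]_d * R | g q.1 <= q.2%:E].

Definition subdiff {d} (g : 'cV[R]_d -> \bar R) (u : 'cV[R]_d)
    : set 'cV[R]_d :=
  [set xi | forall z, g u + (dot xi (z - u)%R)%:E <= g z].

Definition argmin {d} (h : 'cV[R]_d -> \bar R) : set 'cV[R]_d :=
  [set u | forall z, h u <= h z].

Definition prox {d} (H : 'M[R]_d) (g : 'cV[R]_d -> \bar R) (v : 'cV[R]_d)
    : set 'cV[R]_d :=
  argmin (fun u => g u + (2^-1 * wnorm2 H (u - v))%:E).

(* Extended-real valued, so that the distance to set0 is +oo. *)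
Definition dist0 {d} (C : set 'cV[R]_d) : \bar R :=
  ereal_inf [set (enorm c)%:E | c in C].

End ConvexAnalysis.

Definition doubly_stochastic {R : realType} {m} (W : 'M[R]_m) : Prop :=
  [/\ forall i j, 0 <= W i j, forall i, \sum_j W i j = 1
    & forall j, \sum_i W i j = 1].

Definition connected_graph {m} (E : rel 'I_m) : Prop :=
  [/\ (0 < m)%N, symmetric E & forall i j, connect E i j].

(* The support condition makes every diagonal entry of W positive, whether or
   not E has self-loops. *)
Definition mixing_matrix {R : realType} {m} (E : rel 'I_m) (W : 'M[R]_m)
    : Prop :=
  [/\ W^T = W, doubly_stochastic W,
      forall u : 'cV[R]_m,
        (1%:M - W) *m u = 0 <-> exists c : R, u = c *: const_mx 1,
      forall i j, i != j -> ~~ E i j -> W i j = 0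
    & forall i j, (i == j) || E i j -> 0 < W i j].

Section LiftedProblem.
Context {R : realType} (m n p : nat).

(* m blocks of size n followed by m blocks of size p; submxcol extracts a
   block. *)
Definition ldim : nat := (\sum_(i < m) n + \sum_(i < m) p)%N.

Definition lift_f (f : 'I_m -> 'cV[R]_n -> R) (x : 'cV[R]_ldim) : R :=
  \sum_(i < m) f i (submxcol (usubmx x) i).

Definition lift_g (g : 'I_m -> 'cV[R]_p -> \bar R) (x : 'cV[R]_ldim) : \bar R :=
  (\sum_(i < m) g i (submxcol (dsubmx x) i))%E.

(* The Kronecker product A (x) I_d, written by blocks. *)
Definition kronI d (A : 'M[R]_m) : 'M[R]_(\sum_(i < m) d) :=
  \mxblock_(i < m, j < m) ((A i j)%:M : 'M[R]_d).

Definition Vmx (W : 'M[R]_m) : 'M[R]_(\sum_(i < m) n) :=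
  kronI n (2^-1 *: (1%:M - W)).

(* diag{U_1, ..., U_m}; mxdiag only takes square blocks. *)
Definition Umx (U : 'I_m -> 'M[R]_(p, n))
    : 'M[R]_(\sum_(i < m) p, \sum_(i < m) n) :=
  \mxblock_(i < m, j < m) (if i == j then U i else 0).

Definition Bmx (W : 'M[R]_m) (U : 'I_m -> 'M[R]_(p, n)) : 'M[R]_ldim :=
  block_mx (psd_sqrt (Vmx W)) 0 (Umx U) (- 1%:M).

(* diag{t_1 I_d, ..., t_m I_d} *)
Definition agent_diag d (t : 'I_m -> R) : 'M[R]_(\sum_(i < m) d) :=
  \mxdiag_(i < m) ((t i)%:M : 'M[R]_d).

(* diag{t_1 I_n, ..., t_m I_n, t_1 I_p, ..., t_m I_p}; this is Gamma for
   t = tau and L_F for t = L. *)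
Definition lift_diag (t : 'I_m -> R) : 'M[R]_ldim :=
  block_mx (agent_diag n t) 0 0 (agent_diag p t).

Definition lagrangian (f : 'I_m -> 'cV[R]_n -> R)
    (g : 'I_m -> 'cV[R]_p -> \bar R) (W : 'M[R]_m) (U : 'I_m -> 'M[R]_(p, n))
    (x y : 'cV[R]_ldim) : \bar R :=
  ((lift_f f x)%:E + lift_g g x + (dot y (Bmx W U *m x))%:E)%E.

Definition saddle_points (f : 'I_m -> 'cV[R]_n -> R)
    (g : 'I_m -> 'cV[R]_p -> \bar R) (W : 'M[R]_m) (U : 'I_m -> 'M[R]_(p, n))
    : set ('cV[R]_ldim * 'cV[R]_ldim) :=
  [set w | (forall y, (lagrangian f g W U w.1 y
                       <= lagrangian f g W U w.1 w.2)%E) /\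
           (forall x, (lagrangian f g W U w.1 w.2
                       <= lagrangian f g W U x w.2)%E)].

Definition KKT (f : 'I_m -> 'cV[R]_n -> R)
    (g : 'I_m -> 'cV[R]_p -> \bar R) (W : 'M[R]_m) (U : 'I_m -> 'M[R]_(p, n))
    (x y : 'cV[R]_ldim) : set 'cV[R]_(ldim + ldim) :=
  [set col_mx (xi + grad (lift_f f) x + (Bmx W U)^T *m y) (- (Bmx W U *m x))
    | xi in subdiff (lift_g g) x].

(* 0 is a neutral default: the step sizes are positive and m > 0. *)
Definition tau_max (tau : 'I_m -> R) : R := \big[Num.max/0]_(i < m) tau i.

Definition Smx (U : 'I_m -> 'M[R]_(p, n)) (tau : 'I_m -> R) (beta : R)
    : 'M[R]_(\sum_(i < m) p) :=
  2 *: agent_diag p tau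
  + Umx U *m agent_diag n tau *m (Umx U)^T
  + (beta / (1 - tau_max tau * beta)) *:
      (Umx U *m (agent_diag n tau *m agent_diag n tau) *m (Umx U)^T).

Definition Qmx (U : 'I_m -> 'M[R]_(p, n)) (tau : 'I_m -> R) (beta : R)
    : 'M[R]_ldim :=
  block_mx (beta^-1)%:M 0 0 (Smx U tau beta).

Definition Mmx (W : 'M[R]_m) (U : 'I_m -> 'M[R]_(p, n)) (L tau : 'I_m -> R)
    (beta : R) : 'M[R]_(ldim + ldim) :=
  block_mx (invmx (lift_diag tau) - 2^-1 *: lift_diag L) 0
           0 (Qmx U tau beta - Bmx W U *m lift_diag tau *m (Bmx W U)^T).

(* The point at which prox is evaluated: x - Gamma grad F(x) - Gamma B^T y. *)
Definition forward_step (f : 'I_m -> 'cV[R]_n -> R) (W : 'M[R]_m)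
    (U : 'I_m -> 'M[R]_(p, n)) (tau : 'I_m -> R) (x y : 'cV[R]_ldim)
    : 'cV[R]_ldim :=
  x - lift_diag tau *m grad (lift_f f) x
    - lift_diag tau *m ((Bmx W U)^T *m y).

(* The initial x 0 is arbitrary, and the entry xbar 0 is unused. *)
Definition DISA (f : 'I_m -> 'cV[R]_n -> R)
    (g : 'I_m -> 'cV[R]_p -> \bar R) (W : 'M[R]_m) (U : 'I_m -> 'M[R]_(p, n))
    (tau : 'I_m -> R) (beta : R) (x xbar y : nat -> 'cV[R]_ldim) : Prop :=
  y 0%N = 0 /\
  forall k : nat,
    [/\ prox (invmx (lift_diag tau)) (lift_g g)
          (forward_step f W U tau (x k) (y k)) (xbar k.+1),
        argmin (fun z => (2^-1 * wnorm2 (Qmx U tau beta) (z - y k)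
                          - dot ((Bmx W U)^T *m z) (xbar k.+1))%:E) (y k.+1)
      & prox (invmx (lift_diag tau)) (lift_g g)
          (forward_step f W U tau (x k) (y k.+1)) (x k.+1)].

End LiftedProblem.

Section Averages.
Context {R : realType}.

Definition average (a : nat -> R) (K : nat) : R^o :=
  K%:R^-1 * \sum_(0 <= k < K) a k.

(* min_{0 <= k <= K-1} a k for K > 0 *)
Definition running_min (a : nat -> R) (K : nat) : R^o :=
  \big[Num.min/a 0%N]_(0 <= k < K) a k.

Definition recip (K : nat) : R^o := K%:R^-1.

End Averages.

(* Main.v *)
Require Import Defs.
From HB Require Import structures.
From mathcomp Require Import all_boot all_order all_algebra.
From mathcomp Require Import all_classical all_reals all_analysis.
From mathcomp Require Import ring lra zify.

(** The iteration is a descent method in the metric diag{Gamma^-1, Q}. Both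
    proximal steps and the saddle point (xs, ys) provide a subgradient of G, at
    x^{k+1}, xbar^{k+1} and xs. Adding the subgradient inequalities around this
    cycle eliminates the values of G ([subdiff_cyclic3]) and leaves inner
    products only:
    - those with Gamma^-1 become differences of squared norms by polarization;
    - since Q (y^{k+1} - y^k) = B xbar^{k+1}, so do the dual ones, up to the
      cross term <B^T (y^{k+1} - y^k), x^{k+1} - xbar^{k+1}>, which Young's
      inequality absorbs at the cost of |B^T (y^{k+1} - y^k)|^2 in the metric
      Gamma;
    - the gradient terms add up to
      <grad F(x^k) - grad F(xs), xs - xbar^{k+1}>, which cocoercivity bounds by
      a quarter of |xbar^{k+1} - x^k|^2 in the metric L_F ([grad_three_point]).
    The outcome, [primal_dual_step], is
      D_{k+1} + |w^k - v^{k+1}|_M^2 <= D_k,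
    where D_k is the squared distance of w^k to the saddle point. As Q is
    positive, D_k >= 0 and the gaps |w^k - v^{k+1}|_M^2 have bounded partial
    sums.

    The metric M dominates a positive multiple of the Euclidean one ([Mmx_lb]).
    For its dual block this is [dual_metric_lb]: completing the square in the
    cross term of B Gamma B^T uses up the last summand of S and reduces the
    question to a bound V <= (1 - d) I with d > 0, which holds because W has a
    positive diagonal.

    For the residual, the subgradient produced by the first proximal step gives
    an explicit element of the KKT set at v^{k+1}. It is a linear image of
    w^k - v^{k+1} plus a difference of gradients, hence its squared norm is at
    most a multiple of the gap ([residual_bound], [Mmx_lb]), and it is summable
    as well. Summable nonnegative sequences have averages O(1/K), and running
    minima o(1/K), because a minimum over K terms is at most the mean of the
    last half of them. *)

Set Implicit Arguments.
Unset Strict Implicit.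
Unset Printing Implicit Defensive.

Import Order.TTheory GRing.Theory Num.Theory.
Import numFieldNormedType.Exports.
Local Open Scope classical_set_scope.
Local Open Scope ring_scope.

(** * The Euclidean inner product *)

Section Dot.
Context {R : realType} {d : nat}.
Implicit Types u v w : 'cV[R]_d.

Lemma dotE u v : dot u v = (u^T *m v) 0 0.
Proof. by rewrite mxE; apply: eq_bigr => i _; rewrite mxE. Qed.

Lemma dotC u v : dot u v = dot v u.
Proof. by apply: eq_bigr => i _; rewrite mulrC. Qed.

Lemma dotDl u v w : dot (u + v) w = dot u w + dot v w.
Proof. by rewrite !dotE linearD mulmxDl mxE. Qed.

Lemma dotNl u v : dot (- u) v = - dot u v.
Proof. by rewrite !dotE linearN mulNmx mxE. Qed.

Lemma dotZl a u v : dot (a *: u) v = a * dot u v.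
Proof. by rewrite !dotE linearZ -scalemxAl mxE. Qed.

Lemma dotBl u v w : dot (u - v) w = dot u w - dot v w.
Proof. by rewrite dotDl dotNl. Qed.

Lemma dotDr u v w : dot u (v + w) = dot u v + dot u w.
Proof. by rewrite !dotE mulmxDr mxE. Qed.

Lemma dotNr u v : dot u (- v) = - dot u v.
Proof. by rewrite !dotE mulmxN mxE. Qed.

Lemma dotZr a u v : dot u (a *: v) = a * dot u v.
Proof. by rewrite !dotE -scalemxAr mxE. Qed.

Lemma dotBr u v w : dot u (v - w) = dot u v - dot u w.
Proof. by rewrite dotDr dotNr. Qed.

Lemma dot0l u : dot 0 u = 0.
Proof. by rewrite dotE trmx0 mul0mx mxE. Qed.

Lemma dot0r u : dot u 0 = 0.
Proof. by rewrite dotC dot0l. Qed.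

Lemma dot_ge0 u : 0 <= dot u u.
Proof. by apply: sumr_ge0 => i _; rewrite -expr2 sqr_ge0. Qed.

Lemma dot_eq0 u : (dot u u == 0) = (u == 0).
Proof.
apply/eqP/eqP => [/eqP|->]; last by rewrite dot0l.
rewrite psumr_eq0 => [/allP u0|i _]; last by rewrite -expr2 sqr_ge0.
apply/colP => i; rewrite mxE; apply/eqP.
by have := u0 i (mem_index_enum i); rewrite mulf_eq0 orbb.
Qed.

Lemma enorm_ge0 u : 0 <= enorm u.
Proof. exact: sqrtr_ge0. Qed.

Lemma sqr_enorm u : enorm u ^+ 2 = dot u u.
Proof. by rewrite sqr_sqrtr ?dot_ge0. Qed.

Lemma enormN u : enorm (- u) = enorm u.
Proof. by rewrite /enorm dotNl dotNr opprK. Qed.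

Lemma enormZ a u : 0 <= a -> enorm (a *: u) = a * enorm u.
Proof.
move=> a0; rewrite /enorm dotZl dotZr mulrA -expr2 sqrtrM ?sqr_ge0 //.
by rewrite sqrtr_sqr ger0_norm.
Qed.

Lemma dot_le_enorm u v : dot u v <= enorm u * enorm v.
Proof.
have [->|u0] := eqVneq u 0; first by rewrite dot0l mulr_ge0 ?enorm_ge0.
have [->|v0] := eqVneq v 0; first by rewrite dot0r mulr_ge0 ?enorm_ge0.
have pos w : w != 0 -> 0 < enorm w.
  by move=> w0; rewrite sqrtr_gt0 lt_neqAle dot_ge0 eq_sym dot_eq0 w0.
have uv_gt0 := mulr_gt0 (pos _ u0) (pos _ v0).
have := dot_ge0 (enorm v *: u - enorm u *: v).
rewrite !(dotBl, dotBr, dotZl, dotZr) (dotC v u) -!sqr_enorm => H.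
rewrite -(ler_pM2l uv_gt0); nra.
Qed.

Lemma dot_young u v : 2 * dot u v <= dot u u + dot v v.
Proof. by have := dot_ge0 (u - v); rewrite !(dotBl, dotBr) (dotC v u); lra. Qed.

End Dot.

Lemma dot_mulmxr {R : realType} d e (A : 'M[R]_(d, e)) u v :
  dot u (A *m v) = dot (A^T *m u) v.
Proof. by rewrite !dotE trmx_mul trmxK mulmxA. Qed.

Lemma dot_col_mx {R : realType} d e (u1 v1 : 'cV[R]_d) (u2 v2 : 'cV[R]_e) :
  dot (col_mx u1 u2) (col_mx v1 v2) = dot u1 v1 + dot u2 v2.
Proof. by rewrite !dotE tr_col_mx mul_row_col mxE. Qed.

Lemma dot_submxcol {R : realType} m d (u v : 'cV[R]_(\sum_(i < m) d)) :
  dot u v = \sum_(i < m) dot (submxcol u i) (submxcol v i).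
Proof.
rewrite dotE -{1}[u]submxcolK -{1}[v]submxcolK tr_mxcol mul_mxrow_mxcol summxE.
by apply: eq_bigr => i _; rewrite -dotE.
Qed.

(** If [a <= b + t c] for arbitrarily small [t], then [a <= b]; this replaces
    every passage to the limit in first order optimality conditions. *)
Lemma ler_of_small_slope {R : realType} (a b c : R) :
  (forall t : R, 0 < t < 1 -> a <= b + t * c) -> a <= b.
Proof.
move=> h; rewrite leNgt; apply/negP => ba.
pose t := Num.min 2^-1 ((a - b) / (2 * (`|c| + 1))).
have c0 : 0 < 2 * (`|c| + 1) by have := normr_ge0 c; lra.
have t0 : 0 < t.
  by rewrite lt_min; apply/andP; split; [lra|apply: divr_gt0; lra].
have t1 : t < 1 by rewrite gt_min; apply/orP; left; lra.
have tc : t * (2 * (`|c| + 1)) <= a - b.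
  by rewrite -ler_pdivlMr // ge_min lexx orbT.
have /h : 0 < t < 1 by rewrite t0.
have := ler_norm c; nra.
Qed.

(** * Convex functions with Lipschitz gradient *)

Section Gradient.
Context {R : realType} {d : nat}.
Implicit Types (f : 'cV[R]_d -> R) (u v h x z xb : 'cV[R]_d).

Lemma dot_grad f u h : dot (grad f u) h = 'd (f : _ -> R^o) u h.
Proof.
rewrite [in RHS](matrix_sum_delta h) linear_sum /=; apply: eq_bigr => i _.
by rewrite big_ord1 linearZ /= mxE mulrC.
Qed.

Lemma is_derive_line f u h (t : R) :
  differentiable (f : _ -> R^o) (u + t *: h) ->
  is_derive t 1 (fun s : R => f (u + s *: h) : R^o)
    (dot (grad f (u + t *: h)) h).
Proof.
move=> df.
have lin : is_diff t (fun s : R => u + s *: h) (fun s : R => s *: h).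
  by rewrite -[X in is_diff _ _ X]add0r; exact: is_diffD.
have dfl := is_diff_comp lin (differentiableP df).
case: dfl => dfl dfl_val; apply: DeriveDef; first exact: diff_derivable.
by rewrite deriveE // dfl_val /= scale1r dot_grad.
Qed.

Section Smooth.
Variables (f : 'cV[R]_d -> R) (L : R).
Hypothesis L0 : 0 < L.
Hypothesis f_diff : forall u, differentiable (f : _ -> R^o) u.
Hypothesis f_lip :
  forall u v, enorm (grad f u - grad f v) <= L * enorm (u - v).

(** The difference of the two sides, restricted to the segment from [u] to [v],
    has a nonpositive derivative. *)
Lemma descent_ub u v :
  f v <= f u + dot (grad f u) (v - u) + L / 2 * dot (v - u) (v - u).
Proof.
have [h hE] : exists h : 'cV[R]_d, h = v - u by exists (v - u).
rewrite -hE.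
pose psi : R -> R^o := (fun t : R => f (u + t *: h) : R^o)
  - (dot (grad f u) h \*: (@id R^o)) - ((L / 2 * dot h h) \*: (@id R^o) ^+ 2).
pose dpsi t :=
  dot (grad f (u + t *: h)) h - dot (grad f u) h - t * (L * dot h h).
have alg (a b D s : R) : a - b - L / 2 * D * (2 * s) = a - b - s * (L * D).
  by field.
have psi_der (t : R) : is_derive (t : R^o) 1 psi (dpsi t).
  have Dl := is_derive_line (f_diff (u + t *: h)).
  apply: is_derive_eq.
  rewrite /dpsi [(dot _ _)%:A]mulr1 [(2 * _)%:A]mulr1.
  rewrite -[X in _ - X]/(L / 2 * dot h h * (2 * t ^+ 1)) expr1.
  exact: alg.
have psi_le : psi 1 <= psi 0.
  apply: (@ler0_derive1_le_cc _ psi 0 1); rewrite ?in_itv /= ?lexx ?ler01 //.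
  - move=> t; rewrite in_itv /= => /andP[t0 _].
    have [_ dpsiE] := psi_der t; rewrite derive1E dpsiE /dpsi -dotBl.
    have huv : u + t *: h - u = t *: h by rewrite addrAC subrr add0r.
    have := f_lip (u + t *: h) u; rewrite huv => lip.
    have := dot_le_enorm (grad f (u + t *: h) - grad f u) h.
    have t_norm : enorm (t *: h) = t * enorm h.
      exact/enormZ/ltW.
    rewrite t_norm in lip; rewrite subr_le0 -sqr_enorm => /le_trans; apply.
    apply: le_trans (ler_wpM2r (enorm_ge0 h) lip) _.
    by rewrite le_eqVlt; apply/orP; left; apply/eqP; ring.
  - apply: derivable_within_continuous => t _.
    by case: (psi_der t).
move: psi_le; rewrite /psi /= !fctE /= scale0r scale1r addr0.
have -> : u + h = v by rewrite hE addrC subrK.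
rewrite -![_ *: _]/(_ * _).
lra.
Qed.

Lemma dot_grad_diff_le u v h :
  dot (grad f u - grad f v) h <= L * enorm (u - v) * enorm h.
Proof.
exact: le_trans (dot_le_enorm _ _) (ler_wpM2r (enorm_ge0 h) (f_lip u v)).
Qed.

(** Exchanging the end points in [descent_ub] moves the gradient to [v];
    moving it back to [u] costs L |v - u|^2, whence the factor 3. Any quadratic
    error is good enough for the limit in [convex_grad_le]. *)
Lemma descent_lb u v :
  f u + dot (grad f u) (v - u) - 3 * L / 2 * dot (v - u) (v - u) <= f v.
Proof.
have := descent_ub v u; have := dot_grad_diff_le u v (v - u).
have -> : u - v = - (v - u) by rewrite opprB.
move: (grad f u) (grad f v) => a b.
rewrite enormN !(dotNl, dotNr) opprK dotBl -mulrA -expr2 sqr_enorm.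
lra.
Qed.

Hypothesis f_convex : convex_function setT f.

Lemma convex_grad_le u v : f u + dot (grad f u) (v - u) <= f v.
Proof.
suff: dot (grad f u) (v - u) <= f v - f u by lra.
apply: (@ler_of_small_slope _ _ _ (3 * L / 2 * dot (v - u) (v - u))).
move=> t /andP[t0 t1].
have tI : Itv.spec (@Itv.num_sem R) (Itv.Real `[0%Z, 1%Z]) t.
  by rewrite /= /Itv.num_sem /= num_real /= in_itv /= !ltW.
have cvx : f (t *: v + (1 - t) *: u) <= t * f v + (1 - t) * f u.
  by have := @f_convex (Itv.mk tI) v u; rewrite !inE => /(_ I I).
have := descent_lb u (t *: v + (1 - t) *: u).
have -> : t *: v + (1 - t) *: u - u = t *: (v - u).
  by apply/colP => i; rewrite !mxE; ring.
move: (grad f u) => a; rewrite !(dotZl, dotZr) => lb.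
rewrite -(ler_pM2l t0); move: cvx lb; nra.
Qed.

(** The Baillon-Haddad inequality: compare the tangent lower bound at [b] with
    the quadratic upper bound at [a], both at the point
    a - D / L where they are closest, and symmetrize. *)
Lemma grad_cocoercive u v :
  dot (grad f u - grad f v) (grad f u - grad f v)
  <= L * dot (grad f u - grad f v) (u - v).
Proof.
have half a b : dot (grad f a - grad f b) (grad f a - grad f b) <=
    2 * L * (f a - f b - dot (grad f b) (a - b)).
  have := convex_grad_le b (a - L^-1 *: (grad f a - grad f b)).
  have := descent_ub a (a - L^-1 *: (grad f a - grad f b)).
  move: (grad f a) (grad f b) => ga gb.
  have DE : dot (ga - gb) (ga - gb) = dot ga (ga - gb) - dot gb (ga - gb).
    by rewrite -dotBl.
  move: (ga - gb) DE => D DE.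
  have -> : a - L^-1 *: D - b = a - b - L^-1 *: D by rewrite addrAC.
  have -> : a - L^-1 *: D - a = - (L^-1 *: D) by rewrite addrAC subrr sub0r.
  rewrite !(dotNl, dotNr, dotZl, dotZr) [dot gb (_ - _ *: D)]dotBr dotZr opprK.
  have LL : L / 2 * (L^-1 * (L^-1 * dot D D)) = L^-1 * dot D D / 2.
    by field; rewrite gt_eqF.
  rewrite LL => ub lb.
  have : L^-1 * dot D D <= 2 * (f a - f b - dot gb (a - b)).
    have DE' : L^-1 * dot D D = L^-1 * dot ga D - L^-1 * dot gb D.
      by rewrite DE mulrBr.
    lra.
  by rewrite -(ler_pM2l L0) mulrA mulfV ?gt_eqF // mul1r mulrCA mulrA.
have := half u v; have := half v u.
move: (grad f u) (grad f v) => a b.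
have -> : v - u = - (u - v) by rewrite opprB.
have -> : b - a = - (a - b) by rewrite opprB.
rewrite !(dotNl, dotNr) opprK [dot (a - b) (u - v)]dotBl; lra.
Qed.

(** Write D for the difference of the gradients. Cocoercivity turns
    <D, z - x> into at most -|D|^2 / L, which absorbs the |D|^2 / L that Young's
    inequality extracts from <D, x - xb>. The factor 1/4, where the descent
    lemma alone would give 1/2, is what allows step sizes up to 2 / L. *)
Lemma grad_three_point x z xb :
  dot (grad f x - grad f z) (z - xb) <= L / 4 * dot (xb - x) (xb - x).
Proof.
have := grad_cocoercive x z; move: (grad f x - grad f z) => D coco.
have -> : z - xb = - (x - z) - (xb - x).
  by rewrite opprB opprB addrA subrK.
move: (x - z) (xb - x) coco => a b coco.
have := dot_ge0 (D + (L / 2) *: b).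
rewrite !(dotDl, dotDr, dotZl, dotZr) (dotC b D) => sq.
rewrite !dotNr -(ler_pM2l L0).
nra.
Qed.

End Smooth.
End Gradient.

(** * Block diagonal metrics *)

Lemma eq_mulmx_cV {R : realType} d e (A B : 'M[R]_(d, e)) :
  (forall u : 'cV_e, A *m u = B *m u) -> A = B.
Proof.
move=> AB; apply/matrixP => i j.
have := congr1 (fun M : 'cV_d => M i 0) (AB (delta_mx j 0)).
by rewrite -!colE !mxE.
Qed.

Section AgentDiag.
Context {R : realType} {m d : nat}.
Implicit Types (t : 'I_m -> R) (u v : 'cV[R]_(\sum_(i < m) d)).

Lemma submxcol_agent_diag t u i :
  submxcol (agent_diag d t *m u) i = t i *: submxcol u i.
Proof.
by rewrite -{1}[u]submxcolK /agent_diag mul_mxdiag_mxcol mxcolK mul_scalar_mx.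
Qed.

Lemma agent_diagM s t :
  agent_diag d s *m agent_diag d t = agent_diag d (s * t).
Proof.
apply/eq_mulmx_cV => u; apply/mxcolP => i.
by rewrite -mulmxA !submxcol_agent_diag scalerA.
Qed.

Lemma agent_diag1 : agent_diag d (1 : 'I_m -> R) = 1%:M.
Proof. by rewrite /agent_diag -mxdiagZ. Qed.

Lemma dot_agent_diag t u v :
  dot u (agent_diag d t *m v)
  = \sum_(i < m) t i * dot (submxcol u i) (submxcol v i).
Proof.
rewrite dot_submxcol; apply: eq_bigr => i _.
by rewrite submxcol_agent_diag dotZr.
Qed.

Lemma tr_agent_diag t : (agent_diag d t)^T = agent_diag d t.
Proof. by rewrite tr_mxdiag; apply: eq_mxdiag => i; rewrite tr_scalar_mx. Qed.
End AgentDiag.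

Section LiftDiag.
Context {R : realType} {m n p : nat}.
Implicit Types (t : 'I_m -> R) (x : 'cV[R]_(ldim m n p)).

Definition blk1 x i : 'cV[R]_n := submxcol (usubmx x) i.
Definition blk2 x i : 'cV[R]_p := submxcol (dsubmx x) i.

Lemma dot_blk x z : dot x z =
  \sum_(i < m) dot (blk1 x i) (blk1 z i)
  + \sum_(i < m) dot (blk2 x i) (blk2 z i).
Proof. by rewrite -!dot_submxcol -dot_col_mx !vsubmxK. Qed.

Lemma dot_lift_diag t x z : dot x (lift_diag n p t *m z) =
  \sum_(i < m) t i * dot (blk1 x i) (blk1 z i)
  + \sum_(i < m) t i * dot (blk2 x i) (blk2 z i).
Proof.
rewrite -{1}[x]vsubmxK -{1}[z]vsubmxK /lift_diag mul_block_col.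
by rewrite !mul0mx addr0 add0r dot_col_mx !dot_agent_diag.
Qed.

Lemma tr_lift_diag t : (lift_diag n p t)^T = lift_diag n p t.
Proof. by rewrite /lift_diag tr_block_mx !trmx0 !tr_agent_diag. Qed.

Lemma lift_diagM s t :
  lift_diag n p s *m lift_diag n p t = lift_diag n p (s * t).
Proof.
by rewrite /lift_diag mulmx_block !mul0mx !mulmx0 !addr0 !add0r !agent_diagM.
Qed.

Lemma lift_diag1 : lift_diag n p (1 : 'I_m -> R) = 1%:M.
Proof. by rewrite /lift_diag !agent_diag1 -scalar_mx_block. Qed.

Lemma invmx_lift_diag t : (forall i, t i != 0) ->
  invmx (lift_diag n p t) = lift_diag n p (fun i => (t i)^-1).
Proof.
move=> t0.
have tV : lift_diag n p t *m lift_diag n p (fun i => (t i)^-1) = 1%:M.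
  rewrite lift_diagM -lift_diag1; congr (lift_diag n p _); apply/funext => i.
  exact: mulfV.
have /mulmx1_unit[tU _] := tV.
by rewrite -[LHS]mulmx1 -tV mulKmx.
Qed.

Lemma lift_diag_le s t x : (forall i, s i <= t i) ->
  wnorm2 (lift_diag n p s) x <= wnorm2 (lift_diag n p t) x.
Proof.
move=> st; rewrite /wnorm2 !dot_lift_diag.
by apply: lerD; apply: ler_sum => i _; apply: ler_wpM2r; rewrite ?dot_ge0.
Qed.

Lemma wnorm2_lift_diag_cst (c : R) x :
  wnorm2 (lift_diag n p (fun=> c)) x = c * dot x x.
Proof. by rewrite /wnorm2 dot_lift_diag -!mulr_sumr -mulrDr -dot_blk. Qed.

Lemma lift_diag_ge0 t x : (forall i, 0 <= t i) ->
  0 <= wnorm2 (lift_diag n p t) x.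
Proof.
by move=> /(lift_diag_le x); rewrite wnorm2_lift_diag_cst mul0r.
Qed.

End LiftDiag.

(** * The lifted smooth part *)

Section LiftedSmooth.
Context {R : realType} {m n p : nat}.
Implicit Types (u v w x z : 'cV[R]_(ldim m n p)).

Fact blk1_is_linear i : linear (fun x => blk1 x i : 'cV[R]_n).
Proof. by move=> a u v; rewrite /blk1; apply/colP => j; rewrite !mxE. Qed.

Lemma blk1B u v i : blk1 (u - v) i = blk1 u i - blk1 v i.
Proof. by apply/colP => j; rewrite !mxE. Qed.

Lemma is_diff_blk1 i x :
  is_diff x (fun z => blk1 z i : 'cV[R]_n) (fun h => blk1 h i : 'cV[R]_n).
Proof.
have blk_cont : continuous (fun z => blk1 z i : 'cV[R]_n).
  move=> u A /nbhs_ballP[e /= e0 eA].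
  apply/nbhs_ballP; exists e => //= v [_ uv]; apply: eA; split => // j k.
  by rewrite !mxE; exact: uv.
pose blkL := GRing.isLinear.Build _ _ _ _ _ (blk1_is_linear i).
pose blk : {linear 'cV[R]_(ldim m n p) -> 'cV[R]_n} :=
  HB.pack (fun z => blk1 z i) blkL.
apply: DiffDef.
  exact: (@linear_differentiable _ _ _ blk x blk_cont).
exact: (@diff_lin _ _ _ blk x blk_cont).
Qed.

Variables (f : 'I_m -> 'cV[R]_n -> R) (L : 'I_m -> R).
Hypothesis L0 : forall i, 0 < L i.
Hypothesis f_diff : forall i (u : 'cV[R]_n), differentiable (f i : _ -> R^o) u.

Lemma dot_grad_lift x h : dot (grad (lift_f f) x) h =
  \sum_(i < m) dot (grad (f i) (blk1 x i)) (blk1 h i).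
Proof.
have comp_diff i :
    is_diff x (fun z => f i (blk1 z i) : R^o)
      ('d (f i : _ -> R^o) (blk1 x i) \o (fun h => blk1 h i)).
  exact: is_diff_comp (is_diff_blk1 i x) (differentiableP (f_diff i _)).
have liftE : (lift_f f : 'cV[R]_(ldim m n p) -> R^o) =
    \sum_(i < m) (fun z => f i (blk1 z i) : R^o).
  by apply/funext => z; rewrite fct_sumE.
have lift_diff : differentiable (lift_f f : 'cV[R]_(ldim m n p) -> R^o) x.
  by rewrite liftE; apply: differentiable_sum => i; case: (comp_diff i).
rewrite dot_grad -deriveE // liftE.
rewrite derive_sum => [|i].
  apply: eq_bigr => i _; have [df dfE] := comp_diff i.
  by rewrite deriveE // dfE dot_grad.
by apply: diff_derivable; case: (comp_diff i).
Qed.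

Hypothesis f_lip : forall i (u v : 'cV[R]_n),
  enorm (grad (f i) u - grad (f i) v) <= L i * enorm (u - v).

Lemma sum_blk1_le (t : 'I_m -> R) x : (forall i, 0 <= t i) ->
  \sum_(i < m) t i * dot (blk1 x i) (blk1 x i) <= wnorm2 (lift_diag n p t) x.
Proof.
move=> t0; rewrite /wnorm2 dot_lift_diag lerDl.
by apply: sumr_ge0 => i _; rewrite mulr_ge0 ?dot_ge0.
Qed.

(** The quadratic term carries the full metric L_F, including its blocks of size
    [p] on which F is constant; this only weakens the agentwise bounds. *)
Lemma lift_descent u v : lift_f f v <=
  lift_f f u + dot (grad (lift_f f) u) (v - u)
  + 2^-1 * wnorm2 (lift_diag n p L) (v - u).
Proof.
apply: (@le_trans _ _ (lift_f f u + dot (grad (lift_f f) u) (v - u)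
    + 2^-1 * \sum_(i < m) L i * dot (blk1 (v - u) i) (blk1 (v - u) i))).
  rewrite dot_grad_lift mulr_sumr -!big_split /=; apply: ler_sum => i _.
  rewrite mulrA [2^-1 * _]mulrC !blk1B.
  exact: (descent_ub (f_diff i) (f_lip i)).
have := sum_blk1_le (v - u) (fun i => ltW (L0 i)); lra.
Qed.

Lemma dot_grad_lift_diff u v h :
  dot (grad (lift_f f) u - grad (lift_f f) v) h = \sum_(i < m)
    dot (grad (f i) (blk1 u i) - grad (f i) (blk1 v i)) (blk1 h i).
Proof.
have E := congr2 (fun a b => a - b) (dot_grad_lift u h) (dot_grad_lift v h).
apply: etrans (dotBl _ _ _) _; apply: etrans E _; rewrite -sumrB.
by apply: eq_bigr => i _; exact/esym/dotBl.
Qed.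

Lemma lift_grad_lip (C : R) u v : (forall i, L i <= C) ->
  dot (grad (lift_f f) u - grad (lift_f f) v)
      (grad (lift_f f) u - grad (lift_f f) v) <= C ^+ 2 * dot (u - v) (u - v).
Proof.
(* only the action of the gradient difference on vectors matters *)
move=> LC; suff aux (a : 'cV[R]_(ldim m n p)) :
    (forall h, dot a h = \sum_(i < m)
      dot (grad (f i) (blk1 u i) - grad (f i) (blk1 v i)) (blk1 h i)) ->
    dot a a <= C ^+ 2 * dot (u - v) (u - v).
  exact/aux/dot_grad_lift_diff.
move=> aE; have : 2 * dot a a <= \sum_(i < m) 1 * dot (blk1 a i) (blk1 a i)
    + \sum_(i < m) C ^+ 2 * dot (blk1 (u - v) i) (blk1 (u - v) i).
  rewrite {1}aE mulr_sumr -big_split /=; apply: ler_sum => i _.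
  move: (blk1 a i) => ai; rewrite blk1B.
  have := f_lip i (blk1 u i) (blk1 v i).
  move: (grad _ _ - _) (blk1 u i - blk1 v i) => q e qe.
  have := dot_le_enorm q ai; rewrite -!sqr_enorm mul1r.
  have qC : enorm q <= C * enorm e.
    by apply: le_trans qe _; apply: ler_wpM2r; rewrite ?enorm_ge0.
  have := ler_wpM2r (enorm_ge0 ai) qC.
  have := sqr_ge0 (enorm ai - C * enorm e); nra.
have a_le := @sum_blk1_le (fun=> 1) a (fun=> ler01).
have uv_le := @sum_blk1_le (fun=> C ^+ 2) (u - v) (fun=> sqr_ge0 C).
rewrite !wnorm2_lift_diag_cst in a_le uv_le; lra.
Qed.

Hypothesis f_convex : forall i, convex_function setT (f i).

Lemma lift_grad_three_point x z xb :
  dot (grad (lift_f f) x - grad (lift_f f) z) (z - xb)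
  <= 4^-1 * wnorm2 (lift_diag n p L) (xb - x).
Proof.
apply: (@le_trans _ _
    (4^-1 * \sum_(i < m) L i * dot (blk1 (xb - x) i) (blk1 (xb - x) i))).
  rewrite dot_grad_lift_diff mulr_sumr; apply: ler_sum => i _.
  rewrite mulrA [4^-1 * _]mulrC !blk1B.
  exact: (grad_three_point (L0 i) (f_diff i) (f_lip i) (f_convex i)).
have := sum_blk1_le (xb - x) (fun i => ltW (L0 i)); lra.
Qed.

End LiftedSmooth.

(** * Subgradients *)

Section Convex.
Context {R : realType} {d : nat}.
Implicit Types (g : 'cV[R]_d -> \bar R) (u v z : 'cV[R]_d).

Lemma wnorm2Z (H : 'M[R]_d) t z : wnorm2 H (t *: z) = t ^+ 2 * wnorm2 H z.
Proof. by rewrite /wnorm2 -scalemxAr dotZl dotZr mulrA expr2. Qed.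

(** First order optimality for the sum of a convex and a smooth function. All
    that the smooth part has to satisfy is a quadratic upper bound at [u]: along
    the segment to [z] its second order term is O(t^2), negligible against t. *)
Lemma argmin_subdiff g (phi : 'cV[R]_d -> R) (H : 'M[R]_d) (u a : 'cV[R]_d) :
  proper_fun g -> econvex g ->
  (forall z, phi z <= phi u + dot a (z - u) + 2^-1 * wnorm2 H (z - u)) ->
  argmin (fun z => g z + (phi z)%:E)%E u ->
  g u \is a fin_num /\ subdiff g u (- a).
Proof.
move=> [gNy [u0 gu0]] g_cvx phi_ub u_min.
have gu_fin : g u \is a fin_num.
  rewrite fin_numE gNy /=; apply/eqP => guy.
  have := u_min u0; rewrite guy addye //.
  have := gNy u0; case: (g u0) gu0 => //.
split=> // z.
have [gz_fin|] := boolP (g z \is a fin_num); last first.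
  by rewrite fin_numE gNy /= negbK => /eqP ->; rewrite leey.
rewrite -(fineK gu_fin) -(fineK gz_fin) -EFinD lee_fin dotNl.
set gu := fine _; set gz := fine _.
suff : gu - dot a (z - u) <= gz by [].
apply: (@ler_of_small_slope _ _ _ (2^-1 * wnorm2 H (z - u))) => t /andP[t0 t1].
have zt : t *: z + (1 - t) *: u - u = t *: (z - u).
  by apply/colP => i; rewrite !mxE; ring.
have := g_cvx z u t; rewrite t0 t1 => /(_ isT) cvx.
have := u_min (t *: z + (1 - t) *: u) => um.
have := le_trans um (leeD2r _ cvx).
rewrite -(fineK gu_fin) -(fineK gz_fin) -!EFinM -!EFinD lee_fin -/gu -/gz.
have := phi_ub (t *: z + (1 - t) *: u).
rewrite zt dotZr wnorm2Z => ub le.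
rewrite -(ler_pM2l t0); nra.
Qed.

(** Around a cycle the values of [g] cancel. *)
Lemma subdiff_cyclic3 g u1 u2 u3 (s1 s2 s3 : 'cV[R]_d) :
  g u1 \is a fin_num -> g u2 \is a fin_num -> g u3 \is a fin_num ->
  subdiff g u1 s1 -> subdiff g u2 s2 -> subdiff g u3 s3 ->
  dot s1 (u3 - u1) + dot s2 (u1 - u2) + dot s3 (u2 - u3) <= 0.
Proof.
move=> /fineK f1 /fineK f2 /fineK f3 /(_ u3) + /(_ u1) + /(_ u2).
by rewrite -f1 -f2 -f3 -!EFinD !lee_fin; lra.
Qed.

Lemma dist0_bound (C : set 'cV[R]_d) c : C c ->
  dist0 C \is a fin_num /\ fine (dist0 C) ^+ 2 <= dot c c.
Proof.
move=> Cc; have le_c : (dist0 C <= (enorm c)%:E)%E.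
  by apply: ereal_inf_lbound; exists c.
have ge_0 : (0 <= dist0 C)%E.
  by apply: le_ereal_inf_tmp => _ [b _ <-]; rewrite lee_fin enorm_ge0.
have fin : dist0 C \is a fin_num.
  by rewrite ge0_fin_numE // (le_lt_trans le_c) ?ltry.
split=> //; rewrite -sqr_enorm ler_sqr ?nnegrE ?enorm_ge0 ?fine_ge0 //.
by rewrite -lee_fin fineK.
Qed.
End Convex.

Section LiftG.
Context {R : realType} {m n p : nat}.
Variable g : 'I_m -> 'cV[R]_p -> \bar R.
Hypothesis g_convex : forall i, econvex (g i).
Hypothesis g_proper : forall i, proper_fun (g i).

Lemma lift_g_proper : proper_fun (lift_g g : 'cV[R]_(ldim m n p) -> \bar R).
Proof.
split=> [u|].
  rewrite /lift_g; apply/negP => /eqP/esum_eqNyP[i [_ _ /eqP]].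
  by apply/negP; case: (g_proper i).
have /choice[u gu] : forall i, exists u, g i u != +oo%E.
  by move=> i; case: (g_proper i).
exists (col_mx 0 (\mxcol_i u i)).
rewrite /lift_g; apply/negP => /eqP/esum_eqyP[].
  by move=> i _; case: (g_proper i).
move=> i [_ _ /eqP]; rewrite col_mxKd mxcolK; exact/negP.
Qed.

Lemma lift_g_convex : econvex (lift_g g : 'cV[R]_(ldim m n p) -> \bar R).
Proof.
move=> u v t /andP[t0 t1]; rewrite /lift_g.
(* excluding -oo from the sums of values at u and v makes muleDr available *)
pose K (x y z : \bar R) :=
  [/\ y != -oo%E, z != -oo%E & (x <= t%:E * y + (1 - t)%:E * z)%E].
suff [] : K (\sum_(i < m) g i (blk2 (t *: u + (1 - t) *: v) i))%E
  (\sum_(i < m) g i (blk2 u i))%E (\sum_(i < m) g i (blk2 v i))%E by [].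
apply: (big_ind3 K).
- by split=> //; rewrite !mule0 adde0.
- move=> x1 y1 z1 x2 y2 z2 [y1N z1N le1] [y2N z2N le2]; split.
  + by rewrite adde_eq_ninfty negb_or y1N.
  + by rewrite adde_eq_ninfty negb_or z1N.
  + rewrite !muleDr // 1?ltninfty_adde_def ?inE ?ltNye //.
    rewrite addeACA; exact: leeD.
move=> i _; split; [by case: (g_proper i)|by case: (g_proper i)|].
have -> : blk2 (t *: u + (1 - t) *: v) i = t *: blk2 u i + (1 - t) *: blk2 v i.
  by apply/colP => j; rewrite !mxE.
by apply: g_convex; rewrite t0.
Qed.
End LiftG.

(** * Rates for summable nonnegative sequences *)

Section Summable.
Context {R : realType}.
Variables (a : nat -> R) (C : R).
Hypothesis a_ge0 : forall k, 0 <= a k.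
Hypothesis a_sum : forall K, \sum_(0 <= k < K) a k <= C.

Lemma average_bigO : average a =O_\oo recip.
Proof.
apply/eqO_exP; exists (C + 1).
  by have := a_sum 0; rewrite big_nil; lra.
near=> K; rewrite /average /recip normrM mulrC; apply: ler_wpM2r => //.
rewrite ger0_norm ?sumr_ge0 //.
by have := a_sum K; lra.
Unshelve. all: by end_near. Qed.

Lemma sum_tail_small (e : R) : 0 < e ->
  exists N, forall K, \sum_(N <= k < N + K) a k <= e.
Proof.
move=> e0; pose S := [set \sum_(0 <= k < K) a k | K in @setT nat].
have S_sup : has_sup S.
  split; first by exists (\sum_(0 <= k < 0) a k), 0%N.
  by exists C => _ [K _ <-].
have [_ [N _ <-] SN] := sup_adherent e0 S_sup.
exists N => K; have : \sum_(0 <= k < N + K) a k <= sup S.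
  by apply: ub_le_sup; [case: S_sup|exists (N + K)%N].
rewrite (big_cat_nat _ (leq_addr K N)) //=; lra.
Qed.

Lemma running_min_le K k : (k < K)%N -> running_min a K <= a k.
Proof.
move=> kK; rewrite /running_min.
have : k \in index_iota 0 K by rewrite mem_index_iota.
elim: index_iota => // j s IHs; rewrite in_cons big_cons ge_min.
by move=> /predU1P[->|/IHs ->]; rewrite ?lexx ?orbT.
Qed.

Lemma running_min_ge0 K : 0 <= running_min a K.
Proof.
by rewrite /running_min; elim/big_ind: _ => // x y x0 y0; rewrite le_min x0.
Qed.

(** Past an index [N] where the tail of the series is below e / 2, the
    K - N >= K / 2 terms of that tail up to K all dominate the running
    minimum. *)
Lemma running_min_littleo : running_min a =o_\oo recip.
Proof.
apply/eqoP => e e0.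
have [N tail] := @sum_tail_small (e / 2) (divr_gt0 e0 (ltr0Sn _ 1)).
near=> K.
have NK : (N + N < K)%N by near: K; exact: nbhs_infty_gt.
rewrite /recip ger0_norm ?running_min_ge0 // ger0_norm ?invr_ge0 //.
rewrite -[e * _]/(e / K%:R) ler_pdivlMr ?ltr0n; last exact: leq_ltn_trans NK.
have NK' : (N <= K)%N by apply: leq_trans (ltnW NK); exact: leq_addr.
have := tail (K - N)%N; rewrite subnKC //.
have : (K - N)%:R * running_min a K <= \sum_(N <= k < K) a k.
  rewrite mulr_natl -sumr_const_nat big_nat [leRHS]big_nat.
  by apply: ler_sum => k /andP[_]; exact: running_min_le.
have : K%:R <= 2 * (K - N)%:R :> R.
  by rewrite -natrM ler_nat mulnBr mul2n -addnn; lia.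
have := running_min_ge0 K; nra.
Unshelve. all: by end_near. Qed.
End Summable.

(** * The one-step inequality *)

Section Quadratic.
Context {R : realType} {N : nat}.
Implicit Types (H : 'M[R]_N) (u v z a b c : 'cV[R]_N).

Lemma wnorm2N H u : wnorm2 H (- u) = wnorm2 H u.
Proof. by rewrite /wnorm2 mulmxN dotNl dotNr opprK. Qed.

Lemma wnorm2_subC H u v : wnorm2 H (u - v) = wnorm2 H (v - u).
Proof.
have -> : u - v = - (v - u) by rewrite opprB.
exact: wnorm2N.
Qed.

Lemma wnorm2D H u v : H^T = H ->
  wnorm2 H (u + v) = wnorm2 H u + 2 * dot (H *m u) v + wnorm2 H v.
Proof.
move=> Hsym; rewrite /wnorm2 mulmxDr !dotDl !dotDr (dotC v (H *m u)).
by rewrite [dot u (H *m v)]dot_mulmxr Hsym; ring.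
Qed.

Lemma dot_polar H a b c : H^T = H ->
  2 * dot (H *m (a - b)) (c - b)
  = wnorm2 H (a - b) + wnorm2 H (c - b) - wnorm2 H (a - c).
Proof.
move=> Hsym; have -> : a - c = (a - b) + - (c - b).
  by apply/colP => i; rewrite !mxE; ring.
by move: (a - b) (c - b) => u v; rewrite wnorm2D // wnorm2N dotNr; ring.
Qed.

Lemma half_wnorm2_expand H u v z : H^T = H ->
  2^-1 * wnorm2 H (z - v)
  = 2^-1 * wnorm2 H (u - v) + dot (H *m (u - v)) (z - u)
    + 2^-1 * wnorm2 H (z - u).
Proof.
move=> Hsym; have -> : z - v = (u - v) + (z - u).
  by apply/colP => i; rewrite !mxE; ring.
by move: (u - v) (z - u) => a b; rewrite wnorm2D //; field.
Qed.

(** The middle expression is the squared norm of e + H^{-1} c. *)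
Lemma young_inverse H H' e c : H^T = H -> H *m H' = 1%:M ->
  (forall u, 0 <= wnorm2 H u) ->
  0 <= wnorm2 H e + 2 * dot c e + wnorm2 H' c.
Proof.
move=> Hsym HV Hpsd; have := Hpsd (H' *m c + e).
rewrite wnorm2D // mulmxA HV mul1mx {1}/wnorm2 mulmxA HV mul1mx.
by rewrite /wnorm2 (dotC (H' *m c)); lra.
Qed.

End Quadratic.

Section PrimalDualStep.
Context {R : realType} {N : nat}.
Variables (P Gam Q LF B : 'M[R]_N).
Variables (G : 'cV[R]_N -> \bar R) (dF : 'cV[R]_N -> 'cV[R]_N).
Hypothesis P_sym : P^T = P.
Hypothesis Q_sym : Q^T = Q.
Hypothesis P_inv : P *m Gam = 1%:M.
Hypothesis P_psd : forall u, 0 <= wnorm2 P u.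
Hypothesis dF_three_point : forall x z xb : 'cV[R]_N,
  dot (dF x - dF z) (z - xb) <= 4^-1 * wnorm2 LF (xb - x).

(** The Fejer-type inequality behind all four rates. The three subgradients are
    those of the first proximal step at [xb], of the second one at [x'], and of
    the saddle point at [xs]. *)
Lemma primal_dual_step (x xb x' y y' xs ys : 'cV[R]_N) :
  G xb \is a fin_num -> G x' \is a fin_num -> G xs \is a fin_num ->
  subdiff G xb (P *m (x - xb) - dF x - B^T *m y) ->
  Q *m (y' - y) = B *m xb ->
  subdiff G x' (P *m (x - x') - dF x - B^T *m y') ->
  subdiff G xs (- dF xs - B^T *m ys) -> B *m xs = 0 ->
  wnorm2 P (x' - xs) + wnorm2 Q (y' - ys)
  + (wnorm2 P (x - xb) - 2^-1 * wnorm2 LF (x - xb))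
  + (wnorm2 Q (y - y') - wnorm2 Gam (B^T *m (y - y')))
  <= wnorm2 P (x - xs) + wnorm2 Q (y - ys).
Proof.
move=> Gxb Gx' Gxs sxb y_step sx' sxs Bxs.
have := subdiff_cyclic3 Gx' Gxb Gxs sx' sxb sxs.
have tp := dF_three_point x xs xb; rewrite [wnorm2 LF _]wnorm2_subC in tp.
have px' := dot_polar x x' xs P_sym.
have pxb := dot_polar x xb x' P_sym.
have py := dot_polar y y' ys Q_sym.
have yg := young_inverse (x' - xb) (B^T *m (y' - y)) P_sym P_inv P_psd.
have BTxs w : dot (B^T *m w) xs = 0.
  by rewrite -[B]trmxK in Bxs; rewrite dotC dot_mulmxr Bxs dot0l.
have Qxb : dot (Q *m (y - y')) (ys - y') = dot (B^T *m (y' - ys)) xb.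
  have -> : Q *m (y - y') = - (B *m xb).
    by rewrite -y_step -mulmxN opprB.
  by rewrite dotNl -dotNr opprB dotC dot_mulmxr.
have := BTxs ys; have := BTxs y'.
rewrite Qxb in py; move: py yg tp.
rewrite [wnorm2 Gam (B^T *m (y - y'))]/wnorm2.
have -> : B^T *m (y - y') = - (B^T *m (y' - y)) by rewrite -mulmxN opprB.
rewrite mulmxN dotNl dotNr opprK -/(wnorm2 _ _).
rewrite (wnorm2_subC P xs x') in px'; rewrite (wnorm2_subC Q ys y').
(* everything is now linear in the inner products of these eight vectors *)
move: px' pxb; rewrite !mulmxBr.
move: (P *m x) (P *m x') (P *m xb) (B^T *m y) (B^T *m y') (B^T *m ys).
move: (dF x) (dF xs) => a as_ px px' pxb b b' bs.
rewrite !(dotBl, dotBr, dotNl).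
lra.
Qed.
End PrimalDualStep.

(** * Positivity of the metric *)

Lemma pos_lower_bound {R : realType} (I : finType) (a : I -> R) :
  (forall i, 0 < a i) -> exists2 c, 0 < c <= 1 & forall i, c <= a i.
Proof.
move=> a0; exists (\big[Num.min/1]_i a i) => [|i].
  by rewrite lt_bigmin //= bigmin_le_id.
exact: bigmin_inf (lexx _).
Qed.

Section Mixing.
Context {R : realType} {m d : nat}.
Implicit Types (A W : 'M[R]_m) (u : 'cV[R]_(\sum_(i < m) d)).

Lemma submxcol_kronI A u i :
  submxcol (kronI d A *m u) i = \sum_j A i j *: submxcol u j.
Proof.
rewrite -submxcol_mul submxcol_matrix -{1}[u]submxcolK mul_mxrow_mxcol.
by apply: eq_bigr => j _; rewrite mul_scalar_mx.
Qed.

Lemma dot_kronI A u : dot u (kronI d A *m u) =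
  \sum_i \sum_j A i j * dot (submxcol u i) (submxcol u j).
Proof.
rewrite dot_submxcol; apply: eq_bigr => i _.
rewrite submxcol_kronI; elim/big_rec2: _ => [|j x z _ <-].
  by rewrite dot0r.
by rewrite dotDr dotZr.
Qed.

(** By stochasticity of rows and columns, the sum of W_ij |u_i + u_j|^2 is
    2 |u|^2 + 2 <u, (W (x) I) u>, and its diagonal terms alone are at least
    4 c |u|^2. So W (x) I >= (2 c - 1) I, which is the claim for
    V = (I - W (x) I) / 2. *)
Lemma Laplacian_ub W (c : R) u : doubly_stochastic W ->
  (forall i, c <= W i i) -> dot u (Vmx d W *m u) <= (1 - c) * dot u u.
Proof.
move=> [W0 Wr Wc] cW; rewrite dot_kronI.
pose b i j := dot (submxcol u i) (submxcol u j).
have diagE : \sum_i \sum_j (1%:M : 'M[R]_m) i j * b i j = dot u u.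
  rewrite dot_submxcol; apply: eq_bigr => i _.
  rewrite (bigD1 i) //= mxE eqxx mul1r big1 ?addr0 // => j ji.
  by rewrite mxE eq_sym (negbTE ji) mul0r.
have rowE : \sum_i \sum_j W i j * b i i = dot u u.
  rewrite dot_submxcol; apply: eq_bigr => i _.
  by rewrite -mulr_suml Wr mul1r.
have colE : \sum_i \sum_j W i j * b j j = dot u u.
  rewrite exchange_big dot_submxcol; apply: eq_bigr => i _.
  by rewrite -mulr_suml Wc mul1r.
have sum_sq : 4 * c * dot u u <= \sum_i \sum_j
    (W i j * b i i + W i j * b j j + 2 * (W i j * b i j)).
  rewrite {1}dot_submxcol mulr_sumr; apply: ler_sum => i _.
  have sq j : W i j * b i i + W i j * b j j + 2 * (W i j * b i j)
    = W i j * dot (submxcol u i + submxcol u j) (submxcol u i + submxcol u j).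
    rewrite dotDl !dotDr -/(b i i) -/(b i j) -/(b j j) -/(b j i).
    have -> : b j i = b i j by exact: dotC.
    ring.
  rewrite (bigD1 i) //= -[leLHS]addr0; apply: lerD.
    rewrite -/(b i i); have := dot_ge0 (submxcol u i); rewrite -/(b i i).
    by have := cW i; nra.
  by apply: sumr_ge0 => j _; rewrite sq mulr_ge0 ?dot_ge0.
have splitE : \sum_i \sum_j
      (W i j * b i i + W i j * b j j + 2 * (W i j * b i j))
    = \sum_i \sum_j W i j * b i i + \sum_i \sum_j W i j * b j j
      + 2 * \sum_i \sum_j W i j * b i j.
  move: b {diagE rowE colE sum_sq} => b.
  rewrite mulr_sumr -!big_split; apply: eq_bigr => i _ /=.
  by rewrite mulr_sumr -!big_split.
rewrite splitE rowE colE in sum_sq.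
have -> : \sum_i \sum_j
      (2^-1 *: (1%:M - W)) i j * dot (submxcol u i) (submxcol u j)
   = 2^-1 * (dot u u - \sum_i \sum_j W i j * b i j).
  rewrite -diagE -sumrB mulr_sumr; apply: eq_bigr => i _.
  rewrite -sumrB mulr_sumr; apply: eq_bigr => j _.
  by rewrite !mxE -/(b i j); ring.
move: sum_sq; lra.
Qed.

(** The bound holds for any square root of [A], and trivially for 0, the value
    of [psd_sqrt] when there is none. *)
Lemma psd_sqrt_norm (A : 'M[R]_d) (c : R) (u : 'cV[R]_d) : 0 <= c ->
  (forall v : 'cV[R]_d, dot v (A *m v) <= c * dot v v) ->
  dot ((psd_sqrt A)^T *m u) ((psd_sqrt A)^T *m u) <= c * dot u u.
Proof.
move=> c0 Ac; rewrite /psd_sqrt; case: xgetP => [S _ [[Ssym _] SA]|_].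
  by rewrite Ssym -[X in dot (X *m u)]Ssym -dot_mulmxr mulmxA SA.
by rewrite trmx0 mul0mx dot0l mulr_ge0 ?dot_ge0.
Qed.
End Mixing.

Section Metric.
Context {R : realType} {m n p : nat}.
Variables (W : 'M[R]_m) (U : 'I_m -> 'M[R]_(p, n)) (tau : 'I_m -> R) (beta : R).

Lemma tr_Smx : (Smx U tau beta)^T = Smx U tau beta.
Proof.
rewrite /Smx !linearD /= !linearZ /= !trmx_mul !trmxK !tr_agent_diag.
by rewrite !mulmxA.
Qed.

Lemma tr_Qmx : (Qmx U tau beta)^T = Qmx U tau beta.
Proof. by rewrite /Qmx tr_block_mx !trmx0 tr_scalar_mx tr_Smx. Qed.

Lemma wnorm2_mulmx d e (H : 'M[R]_e) (A : 'M[R]_(d, e)) (u : 'cV[R]_d) :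
  dot u (A *m H *m A^T *m u) = wnorm2 H (A^T *m u).
Proof. by rewrite /wnorm2 -!mulmxA dot_mulmxr. Qed.

Lemma wnorm2_Qmx (a : 'cV[R]_(\sum_(i < m) n)) (b : 'cV[R]_(\sum_(i < m) p)) :
  let c := (Umx U)^T *m b in
  wnorm2 (Qmx U tau beta) (col_mx a b) = beta^-1 * dot a a
  + (2 * wnorm2 (agent_diag p tau) b + wnorm2 (agent_diag n tau) c
     + beta / (1 - tau_max tau * beta)
       * dot (agent_diag n tau *m c) (agent_diag n tau *m c)).
Proof.
move=> c; rewrite /wnorm2 /Qmx mul_block_col !mul0mx addr0 add0r dot_col_mx.
rewrite mul_scalar_mx dotZr; congr (_ + _).
rewrite /Smx !mulmxDl !dotDr -!scalemxAl !dotZr; congr (_ * _ + _ + _ * _).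
  exact: wnorm2_mulmx.
by rewrite wnorm2_mulmx /wnorm2 -mulmxA dot_mulmxr tr_agent_diag.
Qed.

Lemma wnorm2_BT (a : 'cV[R]_(\sum_(i < m) n)) (b : 'cV[R]_(\sum_(i < m) p)) :
  wnorm2 (lift_diag n p tau) ((Bmx W U)^T *m col_mx a b)
  = wnorm2 (agent_diag n tau) ((psd_sqrt (Vmx n W))^T *m a + (Umx U)^T *m b)
    + wnorm2 (agent_diag p tau) b.
Proof.
rewrite /Bmx tr_block_mx mul_block_col trmx0 mul0mx add0r linearN /= trmx1.
rewrite mulNmx mul1mx /wnorm2 /lift_diag mul_block_col !mul0mx addr0 add0r.
by rewrite dot_col_mx mulmxN dotNl dotNr opprK.
Qed.

Hypothesis beta0 : 0 < beta.
Hypothesis taubeta : forall i, tau i * beta < 1.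
Hypothesis W_ds : doubly_stochastic W.

Lemma tau_max_beta : tau_max tau * beta < 1.
Proof.
rewrite -ltr_pdivlMr // mul1r; apply/bigmax_ltP.
split=> [|i _]; first by rewrite invr_gt0.
by rewrite -[ltRHS]mul1r ltr_pdivlMr.
Qed.

(** With s = (sqrt V)^T a and c = U^T b, the right-hand side is
    |a|^2 / beta - |s|^2_Gamma1 - 2 <Gamma1 c, s> + |b|^2_Gamma2
    + kappa |Gamma1 c|^2, where kappa = 1 / (1 / beta - tau_max). Completing the
    square in the cross term costs |s|^2 / kappa; together with
    |s|^2_Gamma1 <= tau_max |s|^2 this consumes |s|^2 / beta, which is at most
    (1 - d) |a|^2 / beta. *)
Lemma dual_metric_lb (d : R) (a : 'cV[R]_(\sum_(i < m) n))
    (b : 'cV[R]_(\sum_(i < m) p)) : d <= 1 -> (forall i, d <= W i i) ->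
  d / beta * dot a a + wnorm2 (agent_diag p tau) b
  <= wnorm2 (Qmx U tau beta) (col_mx a b)
     - wnorm2 (lift_diag n p tau) ((Bmx W U)^T *m col_mx a b).
Proof.
move=> d1 dW; rewrite wnorm2_BT wnorm2_Qmx /=.
set s := _^T *m a; set c := _^T *m b.
have ss : dot s s <= (1 - d) * dot a a.
  apply: psd_sqrt_norm; first by rewrite subr_ge0.
  by move=> v; exact: Laplacian_ub.
move: s c ss => s c ss.
have dbeta0 : 0 < 1 - tau_max tau * beta by rewrite subr_gt0 tau_max_beta.
rewrite addrC [s + c]addrC wnorm2D ?tr_agent_diag //.
have s_le : wnorm2 (agent_diag n tau) s <= tau_max tau * dot s s.
  rewrite /wnorm2 dot_agent_diag dot_submxcol mulr_sumr; apply: ler_sum => i _.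
  by apply: ler_wpM2r; rewrite ?dot_ge0 // le_bigmax.
move: (agent_diag n tau *m c) => e.
set kappa := beta / _.
have kappa0 : 0 < kappa by exact: divr_gt0.
have kV : kappa^-1 = beta^-1 - tau_max tau.
  by rewrite /kappa invf_div; field; rewrite gt_eqF.
have := dot_ge0 (kappa *: e - s).
rewrite !(dotBl, dotBr, dotZl, dotZr) (dotC s e) => sq.
have : 2 * dot e s <= kappa * dot e e + kappa^-1 * dot s s.
  rewrite -(ler_pM2l kappa0) mulrDr (mulrA kappa kappa^-1).
  by rewrite mulfV ?gt_eqF // mul1r; lra.
rewrite kV => young.
have b0 : 0 < beta^-1 by rewrite invr_gt0.
have : beta^-1 * dot s s <= beta^-1 * ((1 - d) * dot a a) by rewrite ler_pM2l.
rewrite -[d / beta]mulrC; move: young s_le; rewrite mulrBl; lra.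
Qed.

End Metric.

(** * Optimality conditions of the iteration and of the saddle point *)

Section Optimality.
Context {R : realType} {N : nat}.
Implicit Types (H Q B : 'M[R]_N) (u v z y : 'cV[R]_N) (g : 'cV[R]_N -> \bar R).

Lemma prox_subdiff g H v u : proper_fun g -> econvex g -> H^T = H ->
  prox H g v u -> g u \is a fin_num /\ subdiff g u (H *m (v - u)).
Proof.
move=> g_proper g_convex Hsym u_prox.
have -> : H *m (v - u) = - (H *m (u - v)) by rewrite -mulmxN opprB.
apply: (argmin_subdiff (H := H) g_proper g_convex _ u_prox) => z.
by rewrite (half_wnorm2_expand u).
Qed.

(** The dual step is an unconstrained minimization, that is [argmin_subdiff]
    with the zero function as its nonsmooth part, tested in the direction of the
    residual. *)
Lemma dual_step_eq Q B xb y y' : Q^T = Q ->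
  argmin (fun z => (2^-1 * wnorm2 Q (z - y) - dot (B^T *m z) xb)%:E) y' ->
  Q *m (y' - y) = B *m xb.
Proof.
move=> Qsym y'_min; apply/eqP; rewrite -subr_eq0 -dot_eq0 eq_le dot_ge0 andbT.
set a : 'cV[R]_N := _ - _.
have zero_proper : proper_fun ((fun=> 0%E) : 'cV[R]_N -> \bar R).
  by split=> //; exists 0.
have zero_convex : econvex ((fun=> 0%E) : 'cV[R]_N -> \bar R).
  by move=> u v t _; rewrite !mule0 adde0.
have [//||_ /(_ (y' - a))] := @argmin_subdiff _ _ (fun=> 0%E)
  (fun z => 2^-1 * wnorm2 Q (z - y) - dot (B^T *m z) xb) Q y' a
  zero_proper zero_convex.
- move=> z; rewrite (half_wnorm2_expand y' _ _ Qsym) /a dotBl.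
  have -> : dot (B *m xb) (z - y') = dot (B^T *m z) xb - dot (B^T *m y') xb.
    by rewrite dotC -[B]trmxK -dot_mulmxr trmxK dotBl !dot_mulmxr.
  lra.
- by move=> z; rewrite !add0e.
- rewrite add0e lee_fin addrAC subrr add0r dotNl dotNr opprK; exact.
Qed.

(** The Frobenius norm dominates the operator norm. *)
Lemma mulmx_bound H : exists2 C, 0 <= C &
  forall u, dot (H *m u) (H *m u) <= C * dot u u.
Proof.
exists (\sum_i dot (row i H)^T (row i H)^T) => [|u].
  by apply: sumr_ge0 => i _; exact: dot_ge0.
rewrite {1}/dot mulr_suml; apply: ler_sum => i _.
have -> : (H *m u) i 0 = dot (row i H)^T u.
  by rewrite dotE trmxK -row_mul [RHS]mxE.
move: (row i H)^T => r; rewrite -!sqr_enorm -expr2 -exprMn.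
rewrite -[leLHS]real_normK ?num_real // ler_sqr ?nnegrE ?mulr_ge0 ?enorm_ge0 //.
rewrite ler_norml dot_le_enorm andbT lerNl -dotNl -(enormN r).
exact: dot_le_enorm.
Qed.

(** The left-hand side is the squared norm of the KKT residual, with [e] and [h]
    the primal and dual increments and [q] the difference of the gradients. *)
Lemma residual_bound H Q B (K : R) : 0 <= K -> exists2 C, 0 <= C &
  forall e h q : 'cV[R]_N, dot q q <= K * dot e e ->
    dot (H *m e - q + B *m h) (H *m e - q + B *m h) + dot (Q *m h) (Q *m h)
    <= C * (dot e e + dot h h).
Proof.
move=> K0.
have [C1 C10 H1] := mulmx_bound H; have [C2 C20 H2] := mulmx_bound B.
have [C3 C30 H3] := mulmx_bound Q.
exists (3 * (C1 + K + C2) + C3) => [|e h q qe].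
  by rewrite !(addr_ge0, mulr_ge0).
have := H1 e; have := H2 h; have := H3 h.
move: (H *m e) (B *m h) (Q *m h) => a b c cc bb aa.
have ab := dot_young a b; have aq := dot_young a (- q).
have bq := dot_young b (- q).
rewrite !(dotNl, dotNr) in aq bq.
rewrite !(dotDl, dotDr, dotNl, dotNr) (dotC q a) (dotC b a) (dotC q b).
have := mulr_ge0 C10 (dot_ge0 h); have := mulr_ge0 C20 (dot_ge0 e).
have := mulr_ge0 C30 (dot_ge0 e); have := mulr_ge0 K0 (dot_ge0 h).
rewrite !mulrDl !mulrDr; lra.
Qed.

End Optimality.

Section Saddle.
Context {R : realType} {m n p : nat}.
Variables (f : 'I_m -> 'cV[R]_n -> R) (g : 'I_m -> 'cV[R]_p -> \bar R).
Variables (W : 'M[R]_m) (U : 'I_m -> 'M[R]_(p, n)) (L : 'I_m -> R).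
Hypothesis L0 : forall i, 0 < L i.
Hypothesis f_diff : forall i (u : 'cV[R]_n), differentiable (f i : _ -> R^o) u.
Hypothesis f_lip : forall i (u v : 'cV[R]_n),
  enorm (grad (f i) u - grad (f i) v) <= L i * enorm (u - v).
Hypothesis g_convex : forall i, econvex (g i).
Hypothesis g_proper : forall i, proper_fun (g i).

(** Minimality in x gives the inclusion, and with it the finiteness of G at
    [xs]; only then can the value of G be cancelled from maximality in y, which
    tested at ys + B xs forces B xs = 0. *)
Lemma saddle_point_KKT (xs ys : 'cV[R]_(ldim m n p)) :
  saddle_points f g W U (xs, ys) ->
  [/\ lift_g g xs \is a fin_num, Bmx W U *m xs = 0
    & subdiff (lift_g g) xs (- grad (lift_f f) xs - (Bmx W U)^T *m ys)].
Proof.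
move=> [/= max_y min_x].
have [||G_fin xs_sub] := @argmin_subdiff _ _ (lift_g g)
  (fun x => lift_f f x + dot ys (Bmx W U *m x)) (lift_diag n p L) xs
  (grad (lift_f f) xs + (Bmx W U)^T *m ys)
  (lift_g_proper g_proper) (lift_g_convex g_convex g_proper).
- move=> z; have := lift_descent L0 f_diff f_lip xs z.
  have BzE : dot ys (Bmx W U *m z)
      = dot ys (Bmx W U *m xs) + dot ((Bmx W U)^T *m ys) (z - xs).
    by rewrite -dot_mulmxr mulmxBr dotBr; ring.
  rewrite BzE dotDl; lra.
- move=> z; have := min_x z; rewrite /lagrangian.
  by rewrite ![(_%:E + lift_g g _)%E]addeC -!addeA -!EFinD.
split=> //; last by rewrite -opprD.
apply/eqP; rewrite -dot_eq0 eq_le dot_ge0 andbT.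
have := max_y (ys + Bmx W U *m xs); rewrite /lagrangian -(fineK G_fin) -!EFinD.
by rewrite lee_fin dotDl; lra.
Qed.

End Saddle.

(** * Convergence rates *)

Lemma wnorm2_Mmx {R : realType} m n p (W : 'M[R]_m) (U : 'I_m -> 'M[R]_(p, n))
    (L tau : 'I_m -> R) beta (e h : 'cV[R]_(ldim m n p)) :
  wnorm2 (Mmx W U L tau beta) (col_mx e h)
  = (wnorm2 (invmx (lift_diag n p tau)) e - 2^-1 * wnorm2 (lift_diag n p L) e)
    + (wnorm2 (Qmx U tau beta) h
       - wnorm2 (lift_diag n p tau) ((Bmx W U)^T *m h)).
Proof.
rewrite /wnorm2 /Mmx mul_block_col !mul0mx addr0 add0r dot_col_mx.
by rewrite !mulmxBl !dotBr -scalemxAl dotZr wnorm2_mulmx.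
Qed.

Lemma Mmx_lb {R : realType} m n p (W : 'M[R]_m) (U : 'I_m -> 'M[R]_(p, n))
    (L tau : 'I_m -> R) beta : doubly_stochastic W -> (forall i, 0 < W i i) ->
  0 < beta -> (forall i, 0 < L i) -> (forall i, 0 < tau i < 2 / L i) ->
  (forall i, tau i * beta < 1) ->
  exists2 c, 0 < c & forall e h : 'cV[R]_(ldim m n p),
    c * (dot e e + dot h h) <= wnorm2 (Mmx W U L tau beta) (col_mx e h).
Proof.
move=> W_ds W_diag beta0 L0 tau_bd taubeta.
have tau0 i : 0 < tau i by case/andP: (tau_bd i).
have gap0 i : 0 < (tau i)^-1 - 2^-1 * L i.
  have /andP[_] := tau_bd i; rewrite ltr_pdivlMr ?L0 // subr_gt0 => tauL.
  rewrite -(ltr_pM2l (tau0 i)) mulfV ?gt_eqF //; lra.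
have [c1 /andP[c1_gt0 _] c1_le] := pos_lower_bound gap0.
have [c2 /andP[c2_gt0 _] c2_le] := pos_lower_bound tau0.
have [d /andP[d_gt0 d_le1] d_le] := pos_lower_bound W_diag.
have dbeta : 0 < d / beta by exact: divr_gt0.
pose c := Num.min c1 (Num.min c2 (d / beta)).
have [cc1 cc2 ccd] : [/\ c <= c1, c <= c2 & c <= d / beta].
  by split; rewrite /c !ge_min lexx ?orbT.
exists c => [|e h]; first by rewrite /c !lt_min c1_gt0 c2_gt0.
rewrite wnorm2_Mmx mulrDr; apply: lerD.
  apply: (@le_trans _ _ (c1 * dot e e)); first by rewrite ler_wpM2r ?dot_ge0.
  rewrite -wnorm2_lift_diag_cst invmx_lift_diag => [|i]; last by rewrite gt_eqF.
  rewrite /wnorm2 !dot_lift_diag mulrDr !mulr_sumr opprD addrACA -!sumrB.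
  apply: lerD; apply: ler_sum => i _;
    by rewrite mulrA -mulrBl ler_wpM2r ?dot_ge0.
rewrite -[h]vsubmxK.
apply: le_trans (dual_metric_lb U beta0 taubeta W_ds _ _ d_le1 d_le).
rewrite dot_col_mx mulrDr; apply: lerD; first by rewrite ler_wpM2r ?dot_ge0.
rewrite /wnorm2 dot_agent_diag dot_submxcol mulr_sumr; apply: ler_sum => i _.
by rewrite ler_wpM2r ?dot_ge0 // (le_trans cc2).
Qed.

Theorem theorem2 (R : realType) (m n p : nat)
    (E : rel 'I_m) (W : 'M[R]_m) (U : 'I_m -> 'M[R]_(p, n))
    (f : 'I_m -> 'cV[R]_n -> R) (g : 'I_m -> 'cV[R]_p -> \bar R)
    (L tau : 'I_m -> R) (beta : R)
    (x xbar y : nat -> 'cV[R]_(ldim m n p))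
    (hE : connected_graph E)
    (hW : mixing_matrix E W)
    (hsaddle : saddle_points f g W U !=set0)
    (hL : forall i, 0 < L i)
    (hf_convex : forall i, convex_function setT (f i))
    (hf_diff : forall i u, differentiable (f i : _ -> R^o) u)
    (hf_lip : forall i u v,
      enorm (grad (f i) u - grad (f i) v) <= L i * enorm (u - v))
    (hg_convex : forall i, econvex (g i))
    (hg_proper : forall i, proper_fun (g i))
    (hg_closed : forall i, closed_fun (g i))
    (hbeta : 0 < beta)
    (htau : forall i, 0 < tau i < 2 / L i)
    (htaubeta : forall i, 0 < tau i * beta < 1)
    (hDISA : DISA f g W U tau beta x xbar y) :
  let gap2 (k : nat) : R :=
    wnorm2 (Mmx W U L tau beta)
      (col_mx (x k) (y k) - col_mx (xbar k.+1) (y k.+1)) in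
  let kktdist (k : nat) : \bar R :=
    dist0 (KKT f g W U (xbar k.+1) (y k.+1)) in
  let kktdist2 (k : nat) : R := fine (kktdist k) ^+ 2 in
  (forall k, kktdist k \is a fin_num) /\
  [/\ average gap2 =O_\oo recip,
      running_min gap2 =o_\oo recip,
      average kktdist2 =O_\oo recip
    & running_min kktdist2 =o_\oo recip].
Proof.
move=> gap2 kktdist kktdist2.
have [_ W_ds _ _ W_pos] := hW.
have W_diag i : 0 < W i i by apply: W_pos; rewrite eqxx.
have tau0 i : 0 < tau i by case/andP: (htau i).
have taubeta i : tau i * beta < 1 by case/andP: (htaubeta i).
have [y0 step] := hDISA; have [[xs ys] saddle] := hsaddle.
have G_proper := lift_g_proper (n := n) hg_proper.
have G_convex := lift_g_convex (n := n) hg_convex hg_proper.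
set P := invmx (lift_diag n p tau).
have P_def : P = lift_diag n p (fun i => (tau i)^-1).
  by apply: invmx_lift_diag => i; rewrite gt_eqF.
have P_sym : P^T = P by rewrite P_def tr_lift_diag.
have P_inv : P *m lift_diag n p tau = 1%:M.
  rewrite P_def lift_diagM -lift_diag1; congr (lift_diag n p _).
  by apply/funext => i; apply: mulVf; rewrite gt_eqF.
have P_psd u : 0 <= wnorm2 P u.
  by rewrite P_def; apply: lift_diag_ge0 => i; rewrite invr_ge0 ltW.
have Q_sym := tr_Qmx U tau beta.
have [Gxs Bxs sub_xs] :=
  saddle_point_KKT hL hf_diff hf_lip hg_convex hg_proper saddle.
have prox_sub x0 y1 u : prox P (lift_g g) (forward_step f W U tau x0 y1) u ->
    lift_g g u \is a fin_num /\ subdiff (lift_g g) u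
      (P *m (x0 - u) - grad (lift_f f) x0 - (Bmx W U)^T *m y1).
  move=> /(prox_subdiff G_proper G_convex P_sym)[Gu].
  rewrite /forward_step; move: (grad _ _) (_^T *m _) => q b.
  have -> : x0 - lift_diag n p tau *m q - lift_diag n p tau *m b - u
      = (x0 - u) - lift_diag n p tau *m q - lift_diag n p tau *m b.
    by apply/colP => i; rewrite !mxE; ring.
  by rewrite !(mulmxBr P) !(mulmxA P) P_inv !mul1mx.
have y_step k : Qmx U tau beta *m (y k.+1 - y k) = Bmx W U *m xbar k.+1.
  by have [_ /(dual_step_eq Q_sym)] := step k.
have gapE k : gap2 k = wnorm2 (Mmx W U L tau beta)
    (col_mx (x k - xbar k.+1) (y k - y k.+1)).
  by rewrite /gap2 opp_col_mx add_col_mx.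
pose D k := wnorm2 P (x k - xs) + wnorm2 (Qmx U tau beta) (y k - ys).
have [c c0 M_lb] := Mmx_lb U W_ds W_diag hbeta hL htau taubeta.
have decrease k : D k.+1 + gap2 k <= D k.
  have [/prox_sub[Gxb sub_xb] _ /prox_sub[Gx' sub_x']] := step k.
  have := primal_dual_step P_sym Q_sym P_inv P_psd
    (lift_grad_three_point hL hf_diff hf_lip hf_convex)
    Gxb Gx' Gxs sub_xb (y_step k) sub_x' sub_xs Bxs.
  by rewrite gapE wnorm2_Mmx -/P /D; lra.
have gap_lb k : c * (dot (x k - xbar k.+1) (x k - xbar k.+1)
    + dot (y k - y k.+1) (y k - y k.+1)) <= gap2 k by rewrite gapE.
have gap_ge0 k : 0 <= gap2 k.
  by apply: le_trans (gap_lb k); rewrite mulr_ge0 ?addr_ge0 ?dot_ge0 // ltW.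
have Q_psd u : 0 <= wnorm2 (Qmx U tau beta) u.
  have := M_lb 0 u; rewrite wnorm2_Mmx.
  have := lift_diag_ge0 ((Bmx W U)^T *m u) (fun i => ltW (tau0 i)).
  have := mulr_ge0 (ltW c0)
    (addr_ge0 (dot_ge0 (0 : 'cV_(ldim m n p))) (dot_ge0 u)).
  by rewrite /wnorm2 !dot0l; lra.
have gap_sum K : \sum_(0 <= k < K) gap2 k <= D 0%N.
  suff : \sum_(0 <= k < K) gap2 k + D K <= D 0%N.
    by have := addr_ge0 (P_psd (x K - xs)) (Q_psd (y K - ys)); rewrite /D; lra.
  elim: K => [|K IHK]; first by rewrite big_nil add0r.
  by rewrite big_nat_recr //=; have := decrease K; lra.
have [C C0 res_bound] := residual_bound P (Qmx U tau beta) (Bmx W U)^T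
  (sqr_ge0 (\big[Num.max/0]_i L i)).
have kkt_bound k : kktdist k \is a fin_num /\ kktdist2 k <= C / c * gap2 k.
  have [/prox_sub[_ sub_xb] _ _] := step k.
  have /dist0_bound[dist_fin dist_le] : KKT f g W U (xbar k.+1) (y k.+1)
      (col_mx (P *m (x k - xbar k.+1) - grad (lift_f f) (x k)
               - (Bmx W U)^T *m y k + grad (lift_f f) (xbar k.+1)
               + (Bmx W U)^T *m y k.+1)
              (- (Bmx W U *m xbar k.+1))) by exists (P *m (x k - xbar k.+1)
      - grad (lift_f f) (x k) - (Bmx W U)^T *m y k).
  split=> //; apply: le_trans dist_le _.
  have := lift_grad_lip (C := \big[Num.max/0]_i L i) hf_diff hf_lip
    (x k) (xbar k.+1) (fun i => le_bigmax _ L i).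
  move: (grad _ (x k)) (grad _ (xbar k.+1)) => q q' q_lip.
  have := res_bound _ (y k.+1 - y k) _ q_lip.
  rewrite dot_col_mx dotNl dotNr opprK -y_step.
  have -> : P *m (x k - xbar k.+1) - q - (Bmx W U)^T *m y k + q'
        + (Bmx W U)^T *m y k.+1
      = P *m (x k - xbar k.+1) - (q - q') + (Bmx W U)^T *m (y k.+1 - y k).
    by rewrite [_ *m (y _ - y _)]mulmxBr; apply/colP => i; rewrite !mxE; ring.
  move=> /le_trans; apply; rewrite -mulrA; apply: ler_wpM2l => //.
  rewrite ler_pdivlMl //; apply: le_trans (gap_lb k).
  have -> : y k - y k.+1 = - (y k.+1 - y k) by rewrite opprB.
  by rewrite [dot (- _) _]dotNl dotNr opprK.
have kkt_ge0 k : 0 <= kktdist2 k by exact: sqr_ge0.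
have kkt_sum K : \sum_(0 <= k < K) kktdist2 k <= C / c * D 0%N.
  apply: (@le_trans _ _ (\sum_(0 <= k < K) C / c * gap2 k)).
    by apply: ler_sum => k _; have [] := kkt_bound k.
  by rewrite -mulr_sumr; apply: ler_wpM2l => //; rewrite divr_ge0 // ltW.
split; first by move=> k; have [] := kkt_bound k.
split.
- exact: average_bigO gap_ge0 gap_sum.
- exact: running_min_littleo gap_ge0 gap_sum.
- exact: average_bigO kkt_ge0 kkt_sum.
- exact: running_min_littleo kkt_ge0 kkt_sum.
Qed.
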